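(* Let $k\ge 2$ be an integer. If a graph $G$ satisfies $\operatorname{og}(G)\ge 2k+1$ and $\operatorname{mad}(G)<2+\frac1k$, then $G$ has a $(2k+1:k)$-coloring.
   Context: All graphs are finite and simple. For positive integers $a\ge b$, an $(a:b)$-coloring of $G$ assigns to each vertex of $G$ a $b$-element subset of $[a]=\{1,\ldots,a\}$ so that adjacent vertices receive disjoint sets. The odd girth $\operatorname{og}(G)$ is the length of a shortest odd cycle of $G$, with $\operatorname{og}(G)=\infty$ if $G$ is bipartite. The maximum average degree is $\operatorname{mad}(G)=\max_{H}\frac{2|E(H)|}{|V(H)|}$, where the maximum is over all subgraphs $H\subseteq G$ with at least one vertex. *)

(* Defs.v *)
From mathcomp Require Import all_boot all_order all_algebra.

Set Implicit Arguments.
Unset Strict Implicit.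
Unset Printing Implicit Defensive.

Import Order.TTheory GRing.Theory Num.Theory.

Record sgraph := SGraph {
  vertex :> finType;
  adj : rel vertex;
  adj_sym : symmetric adj;
  adj_irrefl : irreflexive adj }.

Definition edges (G : sgraph) : {set {set G}} :=
  [set E : {set G} | [exists x : G, exists y : G, adj x y && (E == [set x; y])]].

Definition is_cycle (G : sgraph) (c : seq G) : bool :=
  (2 < size c) && ucycleb (@adj G) c.

Definition has_odd_cycle (G : sgraph) (n : nat) : bool :=
  odd n && [exists c : n.-tuple G, is_cycle c].

(* [None] stands for infinity. Restricting to lengths at most #|G| loses
   nothing, since the vertices of a cycle are pairwise distinct. *)
Definition odd_girth (G : sgraph) : option nat :=
  ohead [seq n <- iota 0 #|G|.+1 | has_odd_cycle G n].

(* m <= g, where g = None is infinity. *)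
Definition le_enat (m : nat) (g : option nat) : bool :=
  if g is Some n then m <= n else true.

(* A subgraph is given by its vertex set and its edge set. *)
Definition is_subgraph (G : sgraph) (H : {set G} * {set {set G}}) : bool :=
  (H.2 \subset edges G) && [forall (E | E \in H.2), E \subset H.1].

(* The default value 0 matters only for the graph without vertices: otherwise
   a one-vertex subgraph already contributes 0 to the maximum. *)
Definition mad (G : sgraph) : rat :=
  (\big[Order.max/0]_(H : {set G} * {set {set G}} |
      is_subgraph H && (H.1 != set0)) ((2 * #|H.2|)%:R / #|H.1|%:R))%R.

(* The colour set [a] is represented by 'I_a = {0, ..., a-1}. *)
Definition is_coloring (G : sgraph) (a b : nat) (f : G -> {set 'I_a}) : Prop :=
  (forall x : G, #|f x| = b) /\
  (forall x y : G, adj x y -> [disjoint f x & f y]).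

Definition has_coloring (G : sgraph) (a b : nat) : Prop :=
  exists f : G -> {set 'I_a}, is_coloring b f.

(* Main.v *)
Require Import Defs.
From mathcomp Require Import all_boot all_order all_algebra.
From mathcomp Require Import zify.

Set Implicit Arguments.
Unset Strict Implicit.
Unset Printing Implicit Defensive.

(* Write m = 2k+1. If f is an (m:k)-coloring and x, y are joined by a walk of
   length l, then |f x :&: f y| >= k - r when l = 2r, and
   |f x :&: f y| <= r when l = 2r+1. We relax the coloring problem to
   a system of such constraints between pairs of vertices, each coming from a
   walk of G, and give a constraint of length l the weight m - l. The bound on
   mad says that the constraints inside any nonempty vertex set U have total
   weight less than m|U|; so some vertex v carries weight less than 2m. We
   eliminate v, adding between any two neighbours at distances l and l' from v
   the constraint of length l + l'. This keeps the density bound, because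
   weights w_i at v with sum at most 2m satisfy
   sum_(i<j) (w_i + w_j - m)^+ <= (sum_i w_i - m)^+. By induction the other
   vertices can be colored.

   It remains to color v, which is a Helly property: constraints of total
   weight at most 2m - 1, pairwise compatible, have a common solution B. It is
   shown by induction on k, putting one color a in B and one color b outside B
   such that two heavy constraints both profit, which lowers the total weight
   by 4; any two other constraints are then too light to become
   incompatible. *)

(** * The Helly property *)

Section Helly.
Variables (T : finType).
Implicit Types (A B R S X Y Z : {set T}).

(* The pair (S, u) stands for the constraint u <= #|B :\: S| on a k-set B. For a
   walk of length l to a vertex colored C, S is C if l is odd and ~: C if l is
   even; then weight k S u = 2k+1 - l, unless the constraint is void. *)
Definition weight k S u := if u is 0 then 0 else 2 * u + (#|S| - k).

(** * Single constraints and pairs of constraints on a set of colors *)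

Lemma weight_leq k S S' u u' : (u = 0 -> u' = 0) ->
  (0 < u' -> 2 * u' + (#|S'| - k) <= 2 * u + (#|S| - k.+1)) ->
  weight k S' u' <= weight k.+1 S u.
Proof. by case: u => [->|u] // _; case: u' => [|u'] // ->. Qed.

Lemma weight_leq_pred k S S' u : #|S'| <= k.+1 ->
  weight k S' u.-1 <= weight k.+1 S u.
Proof.
by move=> h; apply: weight_leq => [->|] //; case: u => [|u] //= _; lia.
Qed.

Lemma card_setDU1 A R Z c : c \in A -> c \notin Z ->
  #|A :\: (R :|: Z)| = #|A :\: (R :|: (c |: Z))| + (c \notin R).
Proof.
move=> cA cZ; rewrite (cardsD1 c (A :\: (R :|: Z))) !inE cA (negPf cZ) andbT orbF.
rewrite addnC; congr (_ + _); apply: eq_card => z; rewrite !inE.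
by case: (z == c); rewrite ?orbT ?andbF //=.
Qed.

Lemma card_setDU k A R S : #|A| = 2 * k + 1 -> R \subset A -> S \subset A ->
  #|A :\: (R :|: S)| + #|R| + #|S| = 2 * k + 1 + #|R :&: S|.
Proof.
move=> cA RA SA; have U : R :|: S \subset A by rewrite subUset RA.
have := cardsD A (R :|: S); rewrite (setIidPr U) => E.
by have := cardsUI R S; have := subset_leq_card U; lia.
Qed.

(** Light pairs are compatible for parity reasons. If [u] and [v] are positive, the weight bound
    gives u + v at most k + 1 when both sets have [k] colors, and at most k otherwise; in the first
    case some color lies outside both sets. *)
Lemma weight_pair k A R S u v : #|A| = 2 * k + 1 -> R \subset A -> S \subset A ->
  k <= #|R| <= k.+1 -> k <= #|S| <= k.+1 -> u <= k -> v <= k ->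
  weight k R u + weight k S v <= 2 * k + 2 ->
  u + v <= k + #|A :\: (R :|: S)|.
Proof.
move=> cA RA SA hR hS; have := card_setDU cA RA SA.
by case: u v => [|u] [|v]; rewrite /weight; lia.
Qed.

(** Both constraints profit when a color outside both sets is put in B and a color common to both
    sets is kept out of B. *)
Definition usable A R S := (A :\: (R :|: S) != set0) && (R :&: S != set0).

(** The two sets are nearly complementary: if [#|R| = k] they are disjoint and miss at most one
    color; if [#|R| = k.+1] they cover [A] and share at most one color. *)
Lemma not_usable k A R S : #|A| = 2 * k + 1 -> R \subset A -> S \subset A ->
  k <= #|R| <= k.+1 -> k <= #|S| <= k.+1 -> ~~ usable A R S ->
  #|A :\: (R :|: S)| + #|R| <= k + 1 /\ k + #|R :&: S| <= #|R|.
Proof.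
move=> cA RA SA hR hS; have := card_setDU cA RA SA.
rewrite negb_and !negbK -!cards_eq0.
by move=> E /orP[] /eqP; lia.
Qed.

(* The effect on the constraint (S, u) of deciding that a is in B and b is not;
   eX and eY tell whether an increase by one is affordable for the pairs with
   X and Y. *)
Lemma shrink_constraint k A X Y S u a b (eX eY : bool) :
  #|A| = 2 * k.+1 + 1 -> S \subset A -> k.+1 <= #|S| <= k.+2 ->
  a \in A -> a \notin X -> a \notin Y -> b \in A -> b \in X -> b \in Y ->
  (a \notin S -> b \notin S -> #|S| = k.+2 ->
     exists2 c, c \in S & (eX || (c \notin X)) && (eY || (c \notin Y))) ->
  (a \in S -> b \in S -> #|S| = k.+1 ->
     exists2 c, c \in A :\: S & (eX || (c \in X)) && (eY || (c \in Y))) ->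
  exists Su : {set T} * nat, let: (S', u') := Su in
  [/\ S' \subset A :\ a :\ b, k <= #|S'| <= k.+1,
      [/\ u' <= u, weight k S' u' <= weight k.+1 S u &
          a \notin S -> b \in S -> S' = S :\ b /\ u' = u.-1],
      forall B, B \subset A :\ a :\ b -> u' <= #|B :\: S'| ->
        u <= #|(a |: B) :\: S| &
      0 < u ->
      u' + #|A :\: (X :|: S)| <= u + #|A :\ a :\ b :\: (X :\ b :|: S')| + eX /\
      u' + #|A :\: (Y :|: S)| <= u + #|A :\ a :\ b :\: (Y :\ b :|: S')| + eY].
Proof.
move=> cA SA hS aA aX aY bA bX bY hout hin.
have key R S' : a \notin R -> b \in R -> S' \subset A :\ a :\ b ->
   #|A :\: (R :|: S')| = #|A :\ a :\ b :\: (R :\ b :|: S')|.+1.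
  move=> aR bR /subsetP sS'.
  have aS' : a \notin S' by apply/negP => /sS'; rewrite !inE eqxx !andbF.
  rewrite (cardsD1 a) !inE (negPf aR) (negPf aS') aA /= add1n; congr _.+1.
  apply: eq_card => z; rewrite !inE.
  case: (eqVneq z b) => [->|_]; first by rewrite bR /= !andbF.
  by case: (z == a); case: (z \in R); case: (z \in S'); case: (z \in A).
have ab : a != b by apply: contraNneq aX => ->.
have subS' Z : Z \subset S -> a \notin Z -> b \notin Z -> Z \subset A :\ a :\ b.
  by move=> ZS aZ bZ; rewrite !subsetD1 (subset_trans ZS SA) aZ bZ.
have aB B : B \subset A :\ a :\ b -> (a \notin B) && (b \notin B).
  by rewrite !subsetD1 => /andP[/andP[_ ->] ->].
case: (boolP (a \in S)) => aS; last first.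
  have cSb : #|S| = (b \in S) + #|S :\ b| by exact: cardsD1.
  have NR R : b \in R -> #|A :\: (R :|: S :\ b)| = #|A :\: (R :|: S)|.
    move=> bR; apply: eq_card => z; rewrite !inE.
    by case: (eqVneq z b) => [->|//]; rewrite bR.
  have sb : S :\ b \subset A :\ a :\ b by apply: subS'; rewrite ?subD1set // !inE ?eqxx ?(negPf aS) ?andbF.
  (* With [a] outside [S], putting [a] in B serves the constraint, so [u] drops by one unless
     removing [b] leaves [S] too large. *)
  case: (boolP ((b \in S) || (#|S| == k.+1))) => h.
    have szb : k <= #|S :\ b| <= k.+1.
      by clear -h cSb hS; case: (b \in S) h cSb => /=; [|move/eqP]; lia.
    exists (S :\ b, u.-1); split => //.
    - split => //; first exact: leq_pred.
      by apply: weight_leq_pred; case/andP: szb.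
    - move=> B sB; have /andP[naB nbB] := aB _ sB => hB.
      have -> : (a |: B) :\: S = a |: (B :\: (S :\ b)).
        apply/setP => z; rewrite !inE; case: (eqVneq z a) => [->|_] /=; first by rewrite (negPf aS).
        by case: (eqVneq z b) => [->|_] //=; rewrite (negPf nbB) !andbF.
      by rewrite cardsU1 !inE (negPf naB) andbF /=; clear -hB; lia.
    - move=> u0; have := key X _ aX bX sb; have := key Y _ aY bY sb.
      by rewrite !NR //; clear -u0; lia.
  move: h; rewrite negb_or => /andP[bS nk].
  have cS2 : #|S| = k.+2 by clear -nk hS; lia.
  (* [S] is one color too large. Dropping [c] may cost one avoided color, which [a] repays, so [u]
     is kept. *)
  have [c cS /andP[eXc eYc]] := hout aS bS cS2.
  have ca : c != a by apply: contraNneq aS => <-.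
  have cb : c != b by apply: contraNneq bS => <-.
  have sc : S :\ c \subset A :\ a :\ b.
    by apply: subS'; rewrite ?subD1set // !inE ?(negPf aS) ?(negPf bS) ?andbF.
  have cSc : #|S| = 1 + #|S :\ c| by rewrite (cardsD1 c) cS.
  have eSc : c |: S :\ c = S by rewrite setD1K.
  exists (S :\ c, u); split => //.
  - by clear -cSc cS2; lia.
  - split => //; last by rewrite (negPf bS).
    by apply: weight_leq => // _; clear -cSc cS2; lia.
  - move=> B sB hB; apply: leq_trans hB _.
    have /andP[naB nbB] := aB _ sB.
    have -> : (a |: B) :\: S = a |: (B :\: S).
      by apply/setP => z; rewrite !inE; case: (eqVneq z a) => [->|_] //=; rewrite (negPf aS).
    rewrite cardsU1 inE (negPf naB) andbF /=.
    have -> : B :\: S = (B :\: (S :\ c)) :\ c.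
      by apply/setP => z; rewrite !inE; case: (eqVneq z c) => [->|_] //=; rewrite cS.
    by have := cardsD1 c (B :\: (S :\ c)); clear; case: (_ \in _) => /=; lia.
  - move=> u0; have := key X _ aX bX sc; have := key Y _ aY bY sc.
    have cA' : c \in A by exact: (subsetP SA).
    have nc : c \notin S :\ c by rewrite !inE eqxx.
    rewrite (card_setDU1 X cA' nc) (card_setDU1 Y cA' nc) eSc.
    by clear hout hin; case: eX eXc; case: eY eYc => /=; case: (c \in X); case: (c \in Y) => //=; clear; lia.
have cSab : #|S| = 1 + (b \in S) + #|S :\ a :\ b|.
  by rewrite (cardsD1 a) aS (cardsD1 b) !inE eq_sym ab /= addnA.
have sab : S :\ a :\ b \subset A :\ a :\ b.
  by apply: subS'; rewrite ?(subset_trans (subD1set _ _)) ?subD1set // !inE ?eqxx ?andbF.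
have NR R : a \notin R -> b \in R -> #|A :\: (R :|: S :\ a :\ b)| = (#|A :\: (R :|: S)|).+1.
  move=> aR bR; rewrite (@card_setDU1 _ _ _ a) ?inE ?eqxx ?andbF // aR addn1; congr _.+1.
  apply: eq_card => z; rewrite !inE.
  case: (eqVneq z a) => [->|_]; first by rewrite aS !orbT.
  by case: (eqVneq z b) => [->|//]; rewrite bR.
(* With [a] in [S], putting [a] in B does not help: [u] is kept and [S] loses both colors. *)
case: (leqP k #|S :\ a :\ b|) => h.
  exists (S :\ a :\ b, u); split => //.
  - by clear -cSab h hS; lia.
  - by split => //; apply: weight_leq => // _; clear -cSab h hS; lia.
  - move=> B sB hB; apply: leq_trans hB _; apply: subset_leq_card.
    have /andP[naB nbB] := aB _ sB.
    apply/subsetP => z; rewrite !inE.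
    case: (eqVneq z a) => [->|_]; first by rewrite (negPf naB) andbF.
    by case: (eqVneq z b) => [->|_] //=; rewrite (negPf nbB) andbF.
  - move=> u0; have := key X _ aX bX sab; have := key Y _ aY bY sab.
    by rewrite !NR //; clear -u0; lia.
have bS : b \in S by clear -cSab h hS; case: (b \in S) cSab => //; lia.
have cS1 : #|S| = k.+1 by move: cSab; rewrite bS; clear -h hS; lia.
(* Only k - 1 colors would remain, so a color [c] is added; this only strengthens the constraint on
   B. *)
have [c] := hin aS bS cS1; rewrite inE => /andP[cS cA'] /andP[eXc eYc].
have ca : c != a by apply: contraNneq cS => ->.
have cb : c != b by apply: contraNneq cS => ->.
have nc : c \notin S :\ a :\ b by rewrite !inE (negPf cS) !andbF.
have sc : c |: S :\ a :\ b \subset A :\ a :\ b.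
  by rewrite subUset sab andbT sub1set !inE ca cb.
exists (c |: S :\ a :\ b, u); split => //.
- by rewrite cardsU1 nc; move: cSab; rewrite bS cS1; clear; lia.
- split => //; apply: weight_leq => // _.
  by rewrite cardsU1 nc; move: cSab; rewrite bS cS1; clear; lia.
- move=> B sB hB; apply: leq_trans hB _; apply: subset_leq_card.
  have /andP[naB nbB] := aB _ sB.
  apply/subsetP => z; rewrite !inE.
  case: (eqVneq z a) => [->|_]; first by rewrite (negPf naB) andbF.
  case: (eqVneq z b) => [->|_] //=; first by rewrite (negPf nbB) andbF.
  by rewrite negb_or => /andP[/andP[_ ->] ->].
- move=> u0; have := key X _ aX bX sc; have := key Y _ aY bY sc.
  have := card_setDU1 X cA' nc; have := card_setDU1 Y cA' nc; rewrite !NR //.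
  by clear hout hin; case: eX eXc; case: eY eYc => /=; case: (c \in X); case: (c \in Y) => //=; clear; lia.
Qed.

Lemma exchange R S b : b \in R -> b \notin S -> #|R| <= #|S| ->
  exists2 c, c \in S & c \notin R.
Proof.
move=> bR bS le; apply/subsetPn; apply: contra bS => SR.
by have /eqP-> : S == R by rewrite eqEcard SR.
Qed.

(* If both pairs are tight and S is contained in X :|: Y, adding the two tight
   equations contradicts the bound on the total weight. *)
Lemma repair_out k A X Y S b (eX eY : bool) u v w :
  #|A| = 2 * k + 1 -> X \subset A -> Y \subset A -> S \subset A ->
  k <= #|X| <= k.+1 -> k <= #|Y| <= k.+1 -> #|S| = k.+1 ->
  b \in X -> b \in Y -> b \notin S ->
  (~~ eX -> ~~ eY ->
    [/\ k + #|A :\: (X :|: S)| <= u + w, k + #|A :\: (Y :|: S)| <= v + w,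
      2 * w + 1 <= 2 * u + (#|X| - k), 2 * w + 1 <= 2 * v + (#|Y| - k) &
      2 * u + (#|X| - k) + (2 * v + (#|Y| - k)) + (2 * w + 1) <= 4 * k + 1]) ->
  exists2 c, c \in S & (eX || (c \notin X)) && (eY || (c \notin Y)).
Proof.
move=> cA XA YA SA hX hY cS bX bY bS H.
case: eX eY H => [] [] /= H.
- by have [|c] := exchange bX bS; [lia | exists c].
- by have [|c cS' cY] := exchange bY bS; [lia | exists c].
- by have [|c cS' cX] := exchange bX bS; [lia | exists c; rewrite ?cX].
have [||h1 h2 h3 h4 h5] // := H.
have EX := card_setDU cA XA SA; have EY := card_setDU cA YA SA.
have : ~~ (S \subset X :|: Y).
  apply/negP => /setIidPl SXY.
  have : #|S| <= #|X :&: S| + #|Y :&: S|.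
    rewrite -{1}SXY setIUr ![_ :&: S]setIC.
    by rewrite -cardsUI leq_addr.
  by move: h1 h2 h3 h4 h5 EX EY; rewrite cS; clear -hX hY; lia.
by case/subsetPn => c cS'; rewrite inE negb_or; exists c.
Qed.

(** Dual of [repair_out]: if both pairs are tight and [X :&: Y] lies in [S], counting [S] inside and
    outside [X :|: Y] contradicts the bound on the total weight. *)
Lemma repair_in k A X Y S a (eX eY : bool) u v w :
  #|A| = 2 * k + 1 -> X \subset A -> Y \subset A -> S \subset A ->
  k <= #|X| <= k.+1 -> k <= #|Y| <= k.+1 -> #|S| = k ->
  a \notin X -> a \notin Y -> a \in S ->
  (~~ eX -> ~~ eY ->
    [/\ k + #|A :\: (X :|: S)| <= u + w, k + #|A :\: (Y :|: S)| <= v + w,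
      2 * w <= 2 * u + (#|X| - k), 2 * w <= 2 * v + (#|Y| - k) &
      2 * u + (#|X| - k) + (2 * v + (#|Y| - k)) + 2 * w <= 4 * k + 1]) ->
  exists2 c, c \in A :\: S & (eX || (c \in X)) && (eY || (c \in Y)).
Proof.
move=> cA XA YA SA hX hY cS aX aY aS H.
have lX : #|S| <= #|X| by lia.
have lY : #|S| <= #|Y| by lia.
have inX c : c \in X -> c \in A by exact: (subsetP XA).
have inY c : c \in Y -> c \in A by exact: (subsetP YA).
case: eX eY H => [] [] /= H.
- by have [c cX cS'] := exchange aS aX lX; exists c; rewrite ?inE ?cS' ?inX.
- by have [c cY cS'] := exchange aS aY lY; exists c; rewrite ?inE ?cS' ?inY.
- by have [c cX cS'] := exchange aS aX lX; exists c; rewrite ?inE ?cS' ?inX ?cX.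
have [||h1 h2 h3 h4 h5] // := H.
have EX := card_setDU cA XA SA; have EY := card_setDU cA YA SA.
have EXY := card_setDU cA XA YA.
have : ~~ (X :&: Y \subset S).
  apply/negP => /setIidPl XYS.
  have E1 := cardsUI (X :&: S) (Y :&: S).
  have E2 : #|(X :&: S) :&: (Y :&: S)| = #|X :&: Y|.
    by rewrite setIACA setIid XYS.
  have E3 := cardsID (X :|: Y) S.
  have E4 : #|S :&: (X :|: Y)| = #|X :&: S :|: Y :&: S| by rewrite setIC setIUl.
  have E5 : #|S :\: (X :|: Y)| <= #|A :\: (X :|: Y)| by apply: subset_leq_card; exact: setSD.
  by clear -h1 h2 h3 h4 h5 EX EY EXY E1 E2 E3 E4 E5 hX hY cS; lia.
case/subsetPn => c; rewrite inE => /andP[cX cY] cS'.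
by exists c; rewrite ?inE ?cS' ?inX ?cX.
Qed.

(** * Families of pairwise compatible constraints *)

Section Family.
Variable I : finType.

(** For a [k]-set B, the numbers of its colors outside [S i] and outside [S j] add up to [#|B :\: (S
    i :&: S j)| + #|B :\: (S i :|: S j)|], so the pairwise bound is necessary for a solution. The
    last bound is 2m - 1. *)
Definition feasible k A (S : I -> {set T}) (u : I -> nat) : Prop :=
  [/\ #|A| = 2 * k + 1,
      forall i, S i \subset A /\ k <= #|S i| <= k.+1,
      forall i, u i <= k,
      forall i j, i != j -> u i + u j <= k + #|A :\: (S i :|: S j)| &
      \sum_i weight k (S i) (u i) <= 4 * k + 1].

Definition avoidable k A (S : I -> {set T}) (u : I -> nat) : Prop :=
  exists B, [/\ B \subset A, #|B| = k & forall i, u i <= #|B :\: S i|].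

Lemma weightE k S u : 0 < u -> weight k S u = 2 * u + (#|S| - k).
Proof. by case: u. Qed.

Lemma weight_gt0 k S u : (0 < weight k S u) = (0 < u).
Proof. by case: u => // u; rewrite weightE. Qed.

Lemma leq_sum3 (F : I -> nat) i j l : i != j -> l != i -> l != j ->
  F i + F j + F l <= \sum_t F t.
Proof.
move=> ij li lj; rewrite (bigD1 i) //= (bigD1 j) 1?eq_sym //= (bigD1 l) ?li ?lj //=.
by rewrite !addnA leq_addr.
Qed.

Lemma leq_sum4 (F : I -> nat) i j s t : i != j -> s != t ->
  s \notin [set i; j] -> t \notin [set i; j] ->
  F i + F j + (F s + F t) <= \sum_l F l.
Proof.
rewrite !inE !negb_or => ij st /andP[si sj] /andP[ti tj].
rewrite (bigD1 i) //= (bigD1 j) 1?eq_sym //= (bigD1 s) ?si ?sj //=.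
by rewrite (bigD1 t) ?ti ?tj 1?eq_sym ?st //= !addnA leq_addr.
Qed.

(** The constraints at [x] and [y] each lose weight at least 2, which pays for the drop of the bound
    by 4. Pairs avoiding [x] and [y] stay compatible by [weight_pair]; the three-way alternative on
    weights lets [repair_out] and [repair_in] protect the pairs that meet [x] or [y]. *)
Lemma feasible_step k A (S : I -> {set T}) u x y :
  (forall A' (S' : I -> {set T}) u', feasible k A' S' u' -> avoidable k A' S' u') ->
  feasible k.+1 A S u ->
  let w i := weight k.+1 (S i) (u i) in
  x != y -> 0 < u x -> 0 < u y -> usable A (S x) (S y) ->
  (forall s t, s != t -> s \notin [set x; y] -> t \notin [set x; y] ->
     w s + w t <= 2 * k.+1) ->
  (forall i, i \notin [set x; y] ->
     [|| w x + w i <= 2 * k + 4, w y + w i <= 2 * k + 4 | (w i <= w x) && (w i <= w y)]) ->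
  (forall i, i \notin [set x; y] -> u i <= k) ->
  avoidable k.+1 A S u.
Proof.
move=> IH [cA hS uk pairs sumw] w xy ux uy /andP[/set0Pn[a]].
rewrite !inE negb_or => /andP[/andP[aX aY] aA] /set0Pn[b]; rewrite inE => /andP[bX bY].
move=> others small uk'.
have ab : a != b by apply: contraNneq aX => ->.
have bA : b \in A by apply: (subsetP (hS x).1).
(* The pair of [x] and [i] may get worse by one if it has slack, or if it weighs at most 2k + 4: as
   [x] loses 2, [weight_pair] then applies. *)
pose eX i := (u x + u i < k.+1 + #|A :\: (S x :|: S i)|) || (w x + w i <= 2 * k + 4).
pose eY i := (u y + u i < k.+1 + #|A :\: (S y :|: S i)|) || (w y + w i <= 2 * k + 4).
have wx : w x = 2 * u x + (#|S x| - k.+1) by exact: weightE.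
have wy : w y = 2 * u y + (#|S y| - k.+1) by exact: weightE.
(* When neither increase is affordable, both pairs are tight, and [small] leaves only the case where
   [i] weighs no more than [x] and [y]. *)
have tight i : i \notin [set x; y] -> ~~ eX i -> ~~ eY i ->
    [/\ k.+1 + #|A :\: (S x :|: S i)| <= u x + u i,
        k.+1 + #|A :\: (S y :|: S i)| <= u y + u i,
        2 * u i + (#|S i| - k.+1) <= 2 * u x + (#|S x| - k.+1),
        2 * u i + (#|S i| - k.+1) <= 2 * u y + (#|S y| - k.+1) &
        2 * u x + (#|S x| - k.+1) + (2 * u y + (#|S y| - k.+1))
           + (2 * u i + (#|S i| - k.+1)) <= 4 * k.+1 + 1].
  move=> ixy; rewrite !negb_or -!leqNgt -!ltnNge => /andP[h1 h2] /andP[h3 h4].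
  have := small i ixy; rewrite (leqNgt (w x + _)) h2 (leqNgt (w y + _)) h4 /= => /andP[h5 h6].
  have ui : 0 < u i.
    rewrite lt0n; apply/eqP => ui; have wi : w i = 0 by rewrite /w ui.
    by have := uk x; move: h2; rewrite wi wx; have [_] := hS x; clear; lia.
  have wi : w i = 2 * u i + (#|S i| - k.+1) by exact: weightE.
  move: ixy; rewrite !inE negb_or => /andP[ix iy].
  have := leq_sum3 w xy ix iy; rewrite -wx -wy -wi; split => //.
  by apply: leq_trans sumw.
have xyP i : a \in S i \/ b \notin S i -> a \notin S i \/ b \in S i -> i \notin [set x; y].
  rewrite !inE; case: eqP => [->|_]; first by rewrite (negPf aX) bX => -[].
  by case: eqP => [->|_] //; rewrite (negPf aY) bY => -[].
have hout i : a \notin S i -> b \notin S i -> #|S i| = k.+2 ->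
    exists2 c, c \in S i & (eX i || (c \notin S x)) && (eY i || (c \notin S y)).
  move=> aS bS cS; have ixy : i \notin [set x; y] by apply: xyP; [right|left].
  apply: (repair_out (k := k.+1) (A := A) (b := b) (u := u x) (v := u y) (w := u i)) => //.
  1-5: by case: (hS x) (hS y) (hS i) => ? ? [? ?] [].
  by move=> n1 n2; have := tight i ixy n1 n2; rewrite cS subSnn.
have hin i : a \in S i -> b \in S i -> #|S i| = k.+1 ->
    exists2 c, c \in A :\: S i & (eX i || (c \in S x)) && (eY i || (c \in S y)).
  move=> aS bS cS; have ixy : i \notin [set x; y] by apply: xyP; [left|right].
  apply: (repair_in (k := k.+1) (A := A) (a := a) (u := u x) (v := u y) (w := u i)) => //.
  1-5: by case: (hS x) (hS y) (hS i) => ? ? [? ?] [].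
  by move=> n1 n2; have := tight i ixy n1 n2; rewrite cS subnn !addn0.
have /fin_all_exists[Su HSu] := fun i => shrink_constraint
  (u i) cA (hS i).1 (hS i).2 aA aX aY bA bX bY (hout i) (hin i).
pose S' i := (Su i).1; pose u' i := (Su i).2.
have {HSu} H i : [/\ S' i \subset A :\ a :\ b, k <= #|S' i| <= k.+1,
    [/\ u' i <= u i, weight k (S' i) (u' i) <= w i &
        a \notin S i -> b \in S i -> S' i = S i :\ b /\ u' i = (u i).-1],
    forall B, B \subset A :\ a :\ b -> u' i <= #|B :\: S' i| ->
      u i <= #|(a |: B) :\: S i| &
    0 < u i ->
      u' i + #|A :\: (S x :|: S i)| <= u i + #|A :\ a :\ b :\: (S x :\ b :|: S' i)| + eX i /\
      u' i + #|A :\: (S y :|: S i)| <= u i + #|A :\ a :\ b :\: (S y :\ b :|: S' i)| + eY i].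
  by have := HSu i; rewrite /S' /u'; case: (Su i).
have cA' : #|A :\ a :\ b| = 2 * k + 1.
  by have := cardsD1 a A; have := cardsD1 b (A :\ a); rewrite !inE eq_sym ab aA bA cA; clear; lia.
have [Sx' ux'] : S' x = S x :\ b /\ u' x = (u x).-1 by case: (H x) => _ _ [_ _ h] _ _; exact: h.
have [Sy' uy'] : S' y = S y :\ b /\ u' y = (u y).-1 by case: (H y) => _ _ [_ _ h] _ _; exact: h.
have cSb i : b \in S i -> #|S i| = (#|S i :\ b|).+1 by move=> bi; rewrite (cardsD1 b) bi.
pose w' i := weight k (S' i) (u' i).
have w'le i : w' i <= w i by case: (H i) => _ _ [].
have w'x : w' x + 2 <= w x.
  rewrite wx /w' Sx' ux' (cSb _ bX) subSS.
  by case: (u x) ux => [|[|n]] // _; rewrite /weight /=; clear; lia.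
have w'y : w' y + 2 <= w y.
  rewrite wy /w' Sy' uy' (cSb _ bY) subSS.
  by case: (u y) uy => [|[|n]] // _; rewrite /weight /=; clear; lia.
have u'k i : u' i <= k.
  case: (boolP (i \in [set x; y])) => [|ixy]; last first.
    by apply: leq_trans (uk' i ixy); case: (H i) => _ _ [].
  by rewrite !inE => /orP[] /eqP ->; rewrite ?ux' ?uy'; have := uk x; have := uk y; clear; lia.
have auto i j : w' i + w' j <= 2 * k + 2 ->
    u' i + u' j <= k + #|A :\ a :\ b :\: (S' i :|: S' j)|.
  by apply: weight_pair => //; case: (H i) => ? ? _ _ _; case: (H j).
have pairx i : i != x -> u' x + u' i <= k + #|A :\ a :\ b :\: (S' x :|: S' i)|.
  move=> ix; case: (posnP (u i)) => ui.
    have -> : u' i = 0 by apply/eqP; rewrite -leqn0 -ui; case: (H i) => _ _ [].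
    by rewrite addn0; apply: leq_trans (u'k x) _; rewrite leq_addr.
  case: (leqP (w x + w i) (2 * k + 4)) => hw.
    by apply: auto; have := w'le i; clear -w'x hw; lia.
  case: (H i) => _ _ _ _ /(_ ui)[+ _].
  have := pairs x i; rewrite eq_sym ix => /(_ isT).
  rewrite /eX [w x + w i <= _]leqNgt hw orbF Sx' ux'; move: ux.
  by case: ltnP; clear; lia.
have pairy i : i != y -> u' y + u' i <= k + #|A :\ a :\ b :\: (S' y :|: S' i)|.
  move=> iy; case: (posnP (u i)) => ui.
    have -> : u' i = 0 by apply/eqP; rewrite -leqn0 -ui; case: (H i) => _ _ [].
    by rewrite addn0; apply: leq_trans (u'k y) _; rewrite leq_addr.
  case: (leqP (w y + w i) (2 * k + 4)) => hw.
    by apply: auto; have := w'le i; clear -w'y hw; lia.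
  case: (H i) => _ _ _ _ /(_ ui)[_ +].
  have := pairs y i; rewrite eq_sym iy => /(_ isT).
  rewrite /eY [w y + w i <= _]leqNgt hw orbF Sy' uy'; move: uy.
  by case: ltnP; clear; lia.
have [|B [sB cB hB]] := IH (A :\ a :\ b) S' u'.
- split=> // [i|i j ij|]; first by case: (H i).
  + case: (boolP (i \in [set x; y])) => [|ixy].
      by rewrite !inE => /orP[]/eqP E; rewrite E ?pairx ?pairy // -E eq_sym.
    case: (boolP (j \in [set x; y])) => [|jxy].
      by rewrite !inE addnC setUC => /orP[]/eqP E; rewrite E ?pairx ?pairy // -E.
    by apply: auto; have := others i j ij ixy jxy; have := w'le i; have := w'le j; clear; lia.
  + move: sumw; rewrite (bigD1 x) //= (bigD1 y) 1?eq_sym //= => sumw.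
    rewrite (bigD1 x) //= (bigD1 y) 1?eq_sym //=.
    set s' := \sum_(i | _) _; set s := \sum_(i | _) _ in sumw.
    have : s' <= s by apply: leq_sum => i _; exact: w'le.
    by move: w'x w'y sumw; rewrite /w' /w; clear; lia.
exists (a |: B); split=> [||i]; last by case: (H i) => _ _ _ /(_ _ sB (hB i)).
  rewrite subUset sub1set aA (subset_trans sB) //.
  by rewrite (subset_trans (subD1set _ _)) ?subD1set.
by rewrite cardsU1 cB (contra (subsetP sB a)) // !inE eqxx andbF.
Qed.

(** * Direct construction for a constraint without usable partner *)

Lemma exists_between Y A n : Y \subset A -> #|Y| <= n <= #|A| ->
  exists B, [/\ Y \subset B, B \subset A & #|B| = n].
Proof.
move=> YA /andP[Yn nA]; pose Z := [set z in take (n - #|Y|) (enum (A :\: Y))].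
have ZA : Z \subset A :\: Y by apply/subsetP => z; rewrite inE => /mem_take; rewrite mem_enum.
have cZ : #|Z| = n - #|Y|.
  rewrite cardsE (card_uniqP _) ?take_uniq ?enum_uniq // size_take -cardE.
  have := cardsD A Y; rewrite (setIidPr YA); move: Yn nA; case: ltnP; clear; lia.
exists (Y :|: Z); split; first exact: subsetUl.
  by rewrite subUset YA (subset_trans ZA) ?subsetDl.
rewrite cardsU cZ; have -> : Y :&: Z = set0.
  apply/setP => z; rewrite in_set0; apply/negP; rewrite in_setI => /andP[zY].
  by move/(subsetP ZA); rewrite inE zY.
by rewrite cards0; clear -Yn; lia.
Qed.

Lemma card_bigcup_leq (J : {set I}) (F : I -> {set T}) m :
  (forall j, j \in J -> #|F j| <= m) -> #|\bigcup_(j in J) F j| <= m * #|J|.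
Proof.
move=> h; rewrite mulnC -sum_nat_const.
elim/big_ind2: _ => [|B1 n1 B2 n2 h1 h2|j /h //]; first by rewrite cards0.
by apply: leq_trans (leq_add h1 h2); rewrite cardsU leq_subr.
Qed.

(** All other active sets are nearly complementary to [S p], so B can consist of [u p] colors
    outside [S p] and [k - u p] inside. Only constraints tight with [p] ask for more, at most one
    specific color each, and the weight bound keeps them few. *)
Lemma feasible_not_usable k A (S : I -> {set T}) u p :
  feasible k A S u -> 0 < u p ->
  (forall j, j != p -> 0 < u j -> ~~ usable A (S p) (S j)) ->
  avoidable k A S u.
Proof.
move=> [cA hS uk pairs sumw] up nus.
pose J c := [set j | [&& j != p, 0 < u j & u p + u j == c]].
have pJ c : p \notin J c by rewrite inE eqxx.
have sumJ (K : {set I}) m : p \notin K -> (forall j, j \in K -> m <= weight k (S j) (u j)) ->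
    weight k (S p) (u p) + m * #|K| <= 4 * k + 1.
  move=> pK h; apply: leq_trans sumw; rewrite (bigD1 p) //= leq_add2l.
  rewrite mulnC -sum_nat_const (bigID (mem K) (fun i => i != p)) /=.
  apply: leq_trans (leq_addr _ _); rewrite [leqRHS](eq_bigl (mem K)).
    by apply: leq_sum => j /h.
  by move=> j /=; case: (eqVneq j p) => //= ->; rewrite (negPf pK).
have [SpA hp] := hS p; rewrite weightE // in sumJ.
have cT : #|A :\: S p| = 2 * k + 1 - #|S p| by rewrite cardsD (setIidPr SpA) cA.
have hN j : j != p -> 0 < u j ->
    #|A :\: (S p :|: S j)| + #|S p| <= k + 1 /\ k + #|S p :&: S j| <= #|S p|.
  by move=> jp uj; apply: not_usable => //; [exact: (hS j).1 | exact: (hS j).2 | exact: nus].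
have pairp j : j != p -> u p + u j <= k + #|A :\: (S p :|: S j)|.
  by move=> jp; apply: pairs; rewrite eq_sym.
have [hk|hk] : #|S p| = k \/ #|S p| = k.+1 by clear -hp; lia.
  (* Every active [S j] is disjoint from [S p], so the part of B inside [S p] gives [k - u p]. A
     tight [j] needs one more: the color outside both sets, collected in [Y]. *)
  pose Y := \bigcup_(j in J k.+1) (A :\: (S p :|: S j)).
  have YT : Y \subset A :\: S p.
    by apply/bigcupsP => j _; rewrite setDS // subsetUl.
  have cY : #|Y| <= u p.
    have h1 : #|Y| <= 1 * #|J k.+1|.
      apply: card_bigcup_leq => j; rewrite inE => /and3P[jp uj _].
      by have [] := hN j jp uj; rewrite hk; clear; lia.
    (* More than [u p] tight constraints, each weighing at least [2 * (k.+1 - u p)], would together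
       with [p] exceed the total weight. *)
    apply: leq_trans h1 _; rewrite mul1n leqNgt; apply/negP => h.
    have h2 j : j \in J k.+1 -> 2 * (k.+1 - u p) <= weight k (S j) (u j).
      by rewrite inE => /and3P[_ uj]; rewrite weightE //; clear; lia.
    have := sumJ _ _ (pJ _) h2; rewrite hk subnn addn0; set q := #|J _| in h *.
    have /set0Pn[j] : J k.+1 != set0 by rewrite -card_gt0; clear -h; lia.
    rewrite inE => /and3P[_ uj _].
    have [t ->] : exists t, k = u p + t by exists (k - u p); have := uk p; clear; lia.
    have -> : (u p + t).+1 - u p = t.+1 by clear; lia.
    by move: h up; clear; nia.
  have [B1 [YB1 B1T cB1]] : exists B, [/\ Y \subset B, B \subset A :\: S p & #|B| = u p].
    by apply: exists_between; rewrite // cY cT hk; have := uk p; clear; lia.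
  have [B2 [_ B2S cB2]] : exists B, [/\ set0 \subset B, B \subset S p & #|B| = k - u p].
    by apply: exists_between; rewrite ?sub0set // cards0 hk; clear; lia.
  have B12 : [disjoint B1 & B2].
    by rewrite disjoints_subset (subset_trans B1T) // setDE (subset_trans (subsetIr _ _)) ?setCS.
  have cB : #|B1 :|: B2| = k.
    by rewrite cardsU (disjoint_setI0 B12) cards0 cB1 cB2; have := uk p; clear; lia.
  exists (B1 :|: B2); split=> // [|j].
    by rewrite subUset (subset_trans B1T (subsetDl _ _)) (subset_trans B2S SpA).
  case: (posnP (u j)) => [-> //|uj].
  case: (eqVneq j p) => [->|jp].
    rewrite -{1}cB1; apply: subset_leq_card; rewrite subsetD subsetUl.
    by rewrite disjoints_subset (subset_trans B1T) // setDE subsetIr.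
  have [h1 h2] := hN j jp uj.
  have SjSp : S p :&: S j = set0 by apply/eqP; rewrite -cards_eq0; clear -h2 hk; lia.
  have B2j : B2 \subset (B1 :|: B2) :\: S j.
    apply/subsetP => z zB2; rewrite !inE zB2 orbT andbT; apply: contraFN (in_set0 z) => zSj.
    by rewrite -SjSp inE (subsetP B2S).
  have := pairp j jp; case: (eqVneq (u p + u j) k.+1) => [E|ne] pj; last first.
    apply: leq_trans (subset_leq_card B2j); rewrite cB2; move: ne pj h1.
    by rewrite hk; clear; lia.
  have /set0Pn[z zA] : A :\: (S p :|: S j) != set0.
    by rewrite -card_gt0; clear -E pj; lia.
  have zB1 : z \in B1.
    by apply: (subsetP YB1); apply/bigcupP; exists j; rewrite // inE jp uj E eqxx.
  have : z |: B2 \subset (B1 :|: B2) :\: S j.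
    rewrite subUset B2j sub1set !inE zB1 andbT andbT.
    by move: zA; rewrite !inE negb_or => /andP[/andP[]].
  move/subset_leq_card; apply: leq_trans.
  by rewrite cardsU1 cB2 (disjointFr B12 zB1); clear -E; lia.
(* Now [S p] and [S j] cover [A], so only the part of B inside [S p] counts for [j]. A tight [j]
   forbids the common color of the two sets there; if [#|S j| = k] there is none, which leaves the
   members of [K]. *)
pose K := [set j in J k | #|S j| == k.+1].
pose Y := \bigcup_(j in K) (S p :&: S j).
have YS : Y \subset S p by apply/bigcupsP => j _; exact: subsetIl.
have cY : #|Y| <= (u p).+1.
  have h1 : #|Y| <= 1 * #|K|.
    apply: card_bigcup_leq => j; rewrite !inE => /andP[/and3P[jp uj _] _].
    by have [] := hN j jp uj; rewrite hk; clear; lia.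
  apply: leq_trans h1 _; rewrite mul1n leqNgt; apply/negP => h.
  have h2 j : j \in K -> 2 * (k - u p) + 1 <= weight k (S j) (u j).
    rewrite !inE => /andP[/and3P[_ uj E] /eqP sj]; rewrite weightE // sj.
    by clear -E; lia.
  have pK : p \notin K by rewrite inE negb_and pJ.
  have := sumJ _ _ pK h2; rewrite hk subSnn.
  have /set0Pn[j] : K != set0 by rewrite -card_gt0; clear -h; lia.
  rewrite !inE => /andP[/and3P[_ uj E] _]; set q := #|K| in h *.
  have [t kt] : exists t, k = u p + t by exists (k - u p); have := uk p; clear; lia.
  have t0 : 0 < t by clear -kt E uj; lia.
  have -> : k - u p = t by rewrite kt; clear; lia.
  by rewrite kt; move: h up t0; clear; nia.
have [B1 [_ B1S cB1]] : exists B, [/\ set0 \subset B, B \subset S p :\: Y & #|B| = k - u p].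
  apply: exists_between; rewrite ?sub0set // cards0 cardsD (setIidPr YS) hk.
  by move: cY; clear; lia.
have [B2 [_ B2T cB2]] : exists B, [/\ set0 \subset B, B \subset A :\: S p & #|B| = u p].
  by apply: exists_between; rewrite ?sub0set // cards0 cT hk; have := uk p; clear; lia.
have B1Sp : B1 \subset S p by rewrite (subset_trans B1S) ?subsetDl.
have B12 : [disjoint B2 & B1].
  by rewrite disjoints_subset (subset_trans B2T) // setDE (subset_trans (subsetIr _ _)) ?setCS.
have cB : #|B2 :|: B1| = k.
  by rewrite cardsU (disjoint_setI0 B12) cards0 cB1 cB2; have := uk p; clear; lia.
exists (B2 :|: B1); split=> // [|j].
  by rewrite subUset (subset_trans B2T (subsetDl _ _)) (subset_trans B1Sp SpA).
case: (posnP (u j)) => [-> //|uj].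
case: (eqVneq j p) => [->|jp].
  rewrite -{1}cB2; apply: subset_leq_card; rewrite subsetD subsetUl.
  by rewrite disjoints_subset (subset_trans B2T) // setDE subsetIr.
have [h1 h2] := hN j jp uj; have := pairp j jp.
have -> : #|A :\: (S p :|: S j)| = 0 by clear -h1 hk; lia.
rewrite addn0 => pj.
apply: (@leq_trans #|B1 :\: S j|); last by apply: subset_leq_card; rewrite setSD ?subsetUr.
have cB1j : #|B1 :&: S j| <= #|S p :&: S j| by rewrite subset_leq_card ?setSI.
have := cardsID (S j) B1; rewrite cB1.
case: (eqVneq (u p + u j) k) => [E|ne]; last first.
  by move: ne pj h2 cB1j; rewrite hk; clear; lia.
suff -> : B1 :&: S j = set0 by rewrite cards0; clear -E; lia.
have [sj|sj] := boolP (#|S j| == k.+1).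
  have SjY : S p :&: S j \subset Y by apply: (bigcup_sup j); rewrite !inE jp uj E eqxx.
  apply/setP => z; rewrite in_set0; apply/negP; rewrite inE => /andP[zB1 zSj].
  have := subsetP B1S z zB1; rewrite inE => /andP[/negP zY _]; apply: zY.
  by apply: (subsetP SjY); rewrite inE zSj (subsetP B1Sp).
apply/eqP; rewrite -cards_eq0; have := card_setDU cA SpA (hS j).1.
by have := (hS j).2; clear -h1 hk sj cB1j; lia.
Qed.

(** [Y] and [Z] are both close to the complement of [X], hence close to each other. Otherwise [X] or
    its complement would be covered by at most two colors. *)
Lemma usable_third k A X Y Z : #|A| = 2 * k + 1 -> 1 < k ->
  X \subset A -> Y \subset A -> Z \subset A ->
  k <= #|X| <= k.+1 -> k <= #|Y| <= k.+1 -> k <= #|Z| <= k.+1 ->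
  ~~ usable A X Y -> ~~ usable A X Z -> usable A Y Z.
Proof.
move=> cA k1 XA YA ZA hX hY hZ nXY nXZ.
have [h1 h2] := not_usable cA XA YA hX hY nXY.
have [h3 h4] := not_usable cA XA ZA hX hZ nXZ.
have cXA : #|A :\: X| = 2 * k + 1 - #|X| by rewrite cardsD (setIidPr XA) cA.
have leU (D E F : {set T}) : D \subset E :|: F -> #|D| <= #|E| + #|F|.
  by move=> /subset_leq_card h; apply: leq_trans h _; rewrite cardsU leq_subr.
apply/andP; split; apply/eqP => E0.
  have : X \subset (X :&: Y) :|: (X :&: Z).
    apply/subsetP => t tX; rewrite !inE tX /=.
    have := in_set0 t; rewrite -E0 inE (subsetP XA _ tX) andbT.
    by rewrite !inE => /negbT; rewrite negbK.
  by move/leU; clear -h2 h4 hX k1; lia.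
have : A :\: X \subset (A :\: (X :|: Y)) :|: (A :\: (X :|: Z)).
  apply/subsetP => t; rewrite !inE => /andP[/negPf -> tA]; rewrite tA /= !andbT -negb_and.
  by have := in_set0 t; rewrite -E0 inE => ->.
by move/leU; rewrite cXA; clear -h1 h3 hX k1; lia.
Qed.

(** Partial converse of [weight_pair]. Applied to the two heaviest constraints, it shows that every
    pair is light when these two are not usable. *)
Lemma not_usable_weight k A R S u v : #|A| = 2 * k + 1 ->
  R \subset A -> S \subset A -> k <= #|R| <= k.+1 -> k <= #|S| <= k.+1 ->
  0 < u -> 0 < v -> u + v <= k + #|A :\: (R :|: S)| -> ~~ usable A R S ->
  weight k R u + weight k S v <= 2 * k + 2.
Proof.
move=> cA RA SA hR hS u0 v0 uv /(not_usable cA RA SA hR hS)[h1 h2].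
have := card_setDU cA RA SA; rewrite !weightE //.
by clear -uv h1 h2 hR hS; lia.
Qed.

(** Induction on [k], the work being to choose the pair for [feasible_step]. The two heaviest
    constraints [p] and [q] serve if usable. Otherwise all pairs are light, and [p] with a usable
    partner [j] serves unless some pair [s], [t] away from [p] is too heavy; then a usable pair
    among [p], [s], [t] serves. *)
Lemma feasible_avoidable k A (S : I -> {set T}) u :
  feasible k A S u -> avoidable k A S u.
Proof.
elim: k A S u => [|k IH] A S u F.
  exists set0; split; rewrite ?sub0set ?cards0 // => i.
  by case: F => _ _ /(_ i); rewrite leqn0 => /eqP ->.
have [cA hS uk pairs sumw] := F.
pose w i := weight k.+1 (S i) (u i).
have w0 i : (0 < w i) = (0 < u i) by exact: weight_gt0.
have w2 i : 0 < u i -> 2 * u i <= w i <= 2 * u i + 1.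
  by move=> ui; rewrite /w weightE //; have := (hS i).2; clear; lia.
have wk i : w i <= 2 * k.+1 + 1.
  case: (posnP (u i)) => [ui|/w2]; first by rewrite /w ui.
  by have := uk i; clear; lia.
have [p0 up0|nact] := pickP (fun i => 0 < u i); last first.
  have [B [_ BA cB]] : exists B, [/\ set0 \subset B, B \subset A & #|B| = k.+1].
    by apply: exists_between; rewrite ?sub0set // cards0 cA; clear; lia.
  by exists B; split=> // i; have := nact i; case: (u i).
have [p _ wp] := @arg_maxnP _ p0 xpredT w isT.
have {}wp i : w i <= w p by exact: wp.
have up : 0 < u p by rewrite -w0; apply: leq_trans (wp p0); rewrite w0.
have [j /and3P[jp uj usj]|nus] :=
    pickP (fun j => [&& j != p, 0 < u j & usable A (S p) (S j)]); last first.
  apply: (feasible_not_usable F up) => j jp uj.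
  by have := nus j; rewrite jp uj /= => ->.
have [q qp wq] := @arg_maxnP _ j (fun i => i != p) w jp.
have {}wq i : i != p -> w i <= w q by exact: wq.
have uq : 0 < u q by rewrite -w0; apply: leq_trans (wq j jp); rewrite w0.
have pq : p != q by rewrite eq_sym.
have disj x y s t : x != y -> s != t -> s \notin [set x; y] -> t \notin [set x; y] ->
    w x + w y + (w s + w t) <= 4 * k.+1 + 1.
  by move=> xy st sxy txy; apply: leq_trans (leq_sum4 w xy st sxy txy) sumw.
have [uspq|nuspq] := boolP (usable A (S p) (S q)).
  have le i : i \notin [set p; q] -> (w i <= w p) && (w i <= w q).
    by rewrite !inE negb_or => /andP[ip iq]; rewrite wp // wq.
  apply: (feasible_step IH F pq up uq uspq) => [s t st sxy txy|i ixy|i ixy].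
  - have := disj _ _ _ _ pq st sxy txy; have := le s sxy; have := le t txy.
    by rewrite -/(w s) -/(w t); clear; lia.
  - by rewrite (le i ixy) !orbT.
  - have /andP[h1 h2] := le i ixy.
    move: ixy; rewrite !inE negb_or => /andP[ip iq].
    have h := leq_trans (leq_sum3 w pq ip iq) sumw.
    case: (posnP (u i)) => [-> //|/w2]; clear -h h1 h2; lia.
have wpq : w p + w q <= 2 * k + 4.
  have := not_usable_weight cA (hS p).1 (hS q).1 (hS p).2 (hS q).2 up uq (pairs _ _ pq) nuspq.
  by rewrite -/(w p) -/(w q); clear; lia.
have wij i l : i != l -> w i + w l <= 2 * k + 4.
  move=> il; apply: leq_trans wpq; have [E|ip] := eqVneq i p.
    by rewrite E leq_add2l wq // -E eq_sym.
  by rewrite addnC leq_add // ?wp ?wq.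
have step x y : x != y -> 0 < u x -> 0 < u y -> usable A (S x) (S y) ->
    (forall s t, s != t -> s \notin [set x; y] -> t \notin [set x; y] ->
      w s + w t <= 2 * k.+1) ->
    (forall i, i \notin [set x; y] -> u i <= k) -> avoidable k.+1 A S u.
  move=> xy ux uy us hst hi; apply: (feasible_step IH F xy ux uy us) => // i ixy.
  by rewrite wij //; move: ixy; rewrite !inE negb_or eq_sym => /andP[].
have [/existsP[s /existsP[t /and4P[sp tp st hst]]]|] :=
    boolP [exists s, exists t, [&& s != p, t != p, s != t & 2 * k.+1 < w s + w t]]; last first.
  rewrite negb_exists => /forallP small.
  have {}small s t : s != p -> t != p -> s != t -> w s + w t <= 2 * k.+1.
    move=> sp tp st; have := small s; rewrite negb_exists => /forallP/(_ t).
    by rewrite sp tp st /= -leqNgt.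
  have pj : p != j by rewrite eq_sym.
  apply: (step p j) => // [s t st|i].
    rewrite !inE !negb_or => /andP[sp _] /andP[tp _]; exact: small.
  rewrite !inE negb_or => /andP[ip ij].
  have h := leq_trans (leq_sum3 w pj ip ij) sumw.
  have hi := wp i; have hip := wij i p ip; have wj2 := w2 j uj.
  case: (posnP (u i)) => [-> //|ui]; have := w2 i ui; have := w2 p up.
  clear -h hi hip wj2 uj ui; lia.
have ps : p != s by rewrite eq_sym.
have pt : p != t by rewrite eq_sym.
have us : 0 < u s by rewrite -w0; have := wij p t pt; have := wk t; have := wp s; have := wp t; clear -hst; lia.
have ut : 0 < u t by rewrite -w0; have := wij p s ps; have := wk s; have := wp s; have := wp t; clear -hst; lia.
(* Three active constraints weigh at least 6, while the bound for size 1 is 5. [usable_third] needs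
   this. *)
have k0 : 0 < k.
  have := leq_trans (leq_sum3 w ps tp _) sumw; rewrite eq_sym => /(_ st).
  by have := w2 s us; have := w2 t ut; have := w2 p up; clear -us ut up; lia.
(* The total weight is at most [4 * k.+1 + 1], so a pair above [2 * k.+1] leaves at most [2 * k.+1]
   to any disjoint pair. *)
have heavy x y z : x != y -> z != x -> z != y -> 2 * k.+1 < w x + w y ->
    0 < u x -> 0 < u y -> usable A (S x) (S y) -> avoidable k.+1 A S u.
  move=> xy zx zy wxy ux uy usxy; apply: (step x y) => // [s1 t1 st1 s1xy t1xy|i].
    by have := disj _ _ _ _ xy st1 s1xy t1xy; clear -wxy; lia.
  rewrite !inE negb_or => /andP[ix iy].
  have hx := wij i x ix; have hy := wij i y iy.
  case: (posnP (u i)) => [-> //|ui]; have := w2 i ui.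
  clear -hx hy wxy k0; lia.
have wps : 2 * k.+1 < w p + w s by have := wp t; clear -hst; lia.
have wpt : 2 * k.+1 < w p + w t by have := wp s; clear -hst; lia.
have [usps|nps] := boolP (usable A (S p) (S s)).
  by apply: (heavy p s t) => //; rewrite eq_sym.
have [uspt|npt] := boolP (usable A (S p) (S t)).
  by apply: (heavy p t s).
apply: (heavy s t p) => //.
apply: (usable_third cA _ (hS p).1 (hS s).1 (hS t).1 (hS p).2 (hS s).2 (hS t).2) => //.
Qed.

End Family.
End Helly.

(** * Weights, walks and density *)

Lemma sum_subn_leq (I : finType) (P : pred I) (F : I -> nat) d :
  \sum_(i | P i) (F i - d) <= \sum_(i | P i) F i - d.
Proof. by elim/big_rec2: _ => // i n1 n2 _; lia. Qed.

(* Two disjoint pairs cannot both exceed m, so apart from the pairs containing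
   the largest weight at most one pair counts. *)
Lemma sum_excess (I : finType) (w : I -> nat) m :
  (forall i, w i <= m) -> \sum_i w i <= 2 * m ->
  \sum_i \sum_(j | j != i) (w i + w j - m) <= 2 * (\sum_i w i - m).
Proof.
move=> wm sw.
have [p0 _|I0] := pickP (@predT I); last by rewrite !big_pred0.
have [p _ wp] := @arg_maxnP _ p0 xpredT w isT.
have {}wp i : w i <= w p by exact: wp.
have -> : \sum_i \sum_(j | j != i) (w i + w j - m) =
    2 * (\sum_(j | j != p) (w p + w j - m)) +
    \sum_(i | i != p) \sum_(j | (j != i) && (j != p)) (w i + w j - m).
  rewrite (bigD1 p) //= mul2n -addnn -addnA; congr (_ + _).
  rewrite -big_split; apply: eq_bigr => i ip /=.
  by rewrite (bigD1 p) 1?eq_sym //= [w i + w p]addnC.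
(* If a pair [q], [r] avoiding [p] exceeds [m], all positive excesses lie within [p], [q], [r], and
   their three weights sum to at most [2 * m]. *)
have [/existsP[q /existsP[r /and4P[qp rp qr wqr]]]|small] :=
    boolP [exists q, exists r, [&& q != p, r != p, q != r & m < w q + w r]].
  have sw3 : w p + w q + w r <= \sum_i w i.
    rewrite (bigD1 p) //= (bigD1 q) //= (bigD1 r) ?rp 1?eq_sym ?qr //=.
    by rewrite !addnA leq_addr.
  have out s : s != p -> s != q -> s != r -> w p + w s <= m.
    move=> sp sq sr; move: sw; rewrite (bigD1 p) //= (bigD1 q) //= (bigD1 r) ?rp 1?eq_sym ?qr //=.
    by rewrite (bigD1 s) ?sp ?sq ?sr //=; move: wqr; clear; lia.
  rewrite (bigD1 q) //= (bigD1 r) ?rp 1?eq_sym ?qr //= big1 => [|s /andP[/andP[sp sq] sr]]; last first.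
    by apply/eqP; rewrite subn_eq0 out.
  rewrite (bigD1 q) //= (bigD1 r) ?rp 1?eq_sym ?qr //= big1 => [|s /andP[/andP[sq sp] sr]]; last first.
    by apply/eqP; rewrite subn_eq0 (leq_trans _ (out s _ _ _)) ?leq_add2r.
  rewrite (bigD1 r) ?rp 1?eq_sym ?qr //= (bigD1 q) ?qp ?qr //=.
  rewrite big1 => [|s /andP[/andP[sr sp] sq]]; last first.
    by apply/eqP; rewrite subn_eq0 (leq_trans _ (out s _ _ _)) ?leq_add2r.
  rewrite big1 => [|s /andP[/andP[sp sq] sr]]; last first.
    rewrite big1 // => t /andP[ts tp]; apply/eqP.
    by rewrite subn_eq0 addnC (leq_trans _ (out s _ _ _)) ?leq_add2r.
  by have := wp q; have := wp r; move: sw3 sw wqr; clear; lia.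
rewrite [X in _ + X]big1 => [|i ip]; last first.
  apply: big1 => j /andP[ji jp]; apply/eqP; rewrite subn_eq0 leqNgt; apply: contra small => h.
  by apply/existsP; exists i; apply/existsP; exists j; rewrite ip jp eq_sym ji.
rewrite addn0 leq_mul2l /=.
(* Only pairs with [p] remain. The deficit [m - w p] is charged to every [j], and charging it once
   to the whole sum suffices. *)
rewrite (eq_bigr (fun j => w j - (m - w p))) => [|j _]; last by have := wm p; clear; lia.
apply: leq_trans (sum_subn_leq _ _ _) _.
by rewrite [in leqRHS](bigD1 p) //=; clear; lia.
Qed.

(** * Walks, odd girth and edge counts *)

Section Walks.
Variable G : sgraph.
Implicit Types x y z : G.

Definition walk n x y := exists s, [/\ path (@adj G) x s, last x s = y & size s = n].

Lemma walk_cat a b x y z : walk a x y -> walk b y z -> walk (a + b) x z.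
Proof.
move=> [s [ps ls <-]] [t [pt lt <-]]; exists (s ++ t).
by rewrite cat_path last_cat size_cat ps ls.
Qed.

Lemma walk_sym n x y : walk n x y -> walk n y x.
Proof.
move=> [s [ps ls <-]]; exists (rev (belast x s)).
have E : (fun u v : G => adj v u) =2 (@adj G) by move=> u v; exact: adj_sym.
rewrite -ls rev_path (eq_path E) ps size_rev size_belast; split => //.
by case: s {ps ls} => //= z s; rewrite rev_cons last_rcons.
Qed.

Lemma walk_adj x y : adj x y -> walk 1 x y.
Proof. by move=> xy; exists [:: y]; rewrite /= xy. Qed.

(** An odd closed walk with a repeated vertex splits there into two shorter closed walks, one of
    which is odd. *)
Lemma odd_cycle_girth m (c : seq G) : le_enat m (odd_girth G) ->
  cycle (@adj G) c -> odd (size c) -> m <= size c.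
Proof.
move=> og; have [n] := ubnP (size c); elim: n c => // n IH c sc cc oc.
have [uc|] := boolP (uniq c).
  have s2 : 2 < size c.
    by case: c cc oc {IH uc sc} => [|x [|y [|z c]]] //=; rewrite adj_irrefl.
  have cyc : has_odd_cycle G (size c).
    rewrite /has_odd_cycle oc; apply/existsP; exists (in_tuple c).
    by rewrite /is_cycle /ucycleb /= s2 cc uc.
  move: og; rewrite /odd_girth.
  have : size c \in [seq l <- iota 0 #|G|.+1 | has_odd_cycle G l].
    rewrite mem_filter cyc mem_iota /= add0n ltnS.
    by rewrite -(card_uniqP uc) max_card.
  have : sorted leq [seq l <- iota 0 #|G|.+1 | has_odd_cycle G l].
    by apply: sorted_filter; [exact: leq_trans | exact: iota_sorted].
  case: [seq _ <- _ | _] => //= a s; rewrite (path_sortedE leq_trans) => /andP[/allP al _].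
  by rewrite inE => /orP[/eqP-> //|/al h1 h2]; exact: leq_trans h2 h1.
have split : ~~ uniq c -> exists x p0 p1 p2, c = p0 ++ x :: p1 ++ x :: p2.
  elim: c {sc cc oc IH} => // x c IHc; rewrite /= negb_and negbK => /orP[|/IHc].
    by case/splitPr => p1 p2; exists x, [::], p1, p2.
  by move=> [y [p0 [p1 [p2 ->]]]]; exists y, (x :: p0), p1, p2.
move=> /split[x [p0 [p1 [p2 E]]]].
have : cycle (@adj G) (x :: p1 ++ x :: (p2 ++ p0)).
  by move: cc; rewrite E -(rot_cycle (size p0)) rot_size_cat /= -catA.
rewrite /= rcons_cat cat_path /= => /and3P[h1 h2 h3].
have c1 : cycle (@adj G) (x :: p1) by rewrite /= rcons_path h1 h2.
have c2 : cycle (@adj G) (x :: p2 ++ p0) by [].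
have se : size c = size (x :: p1) + size (x :: p2 ++ p0).
  by rewrite E /= !size_cat /= size_cat /=; clear; lia.
have [o1|o1] := boolP (odd (size (x :: p1))).
  by apply: leq_trans (IH _ _ c1 o1) _; move: sc; rewrite se /=; clear; lia.
have o2 : odd (size (x :: p2 ++ p0)) by move: oc; rewrite se oddD (negPf o1).
by apply: leq_trans (IH _ _ c2 o2) _; move: sc; rewrite se /=; clear; lia.
Qed.

Lemma odd_walk_girth m n x : le_enat m (odd_girth G) -> walk n x x -> odd n -> m <= n.
Proof.
move=> og [s [ps ls <-]] os; apply: odd_cycle_girth => //.
case/lastP: s ps ls os => // s z; rewrite last_rcons => ps zx _.
by rewrite -rot1_cons rot_cycle /= zx; rewrite zx in ps.
Qed.

(** Handshake argument: at most two ordered adjacent pairs give the same edge. *)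
Lemma sum_adj_leq (U : {set G}) :
  \sum_(x in U) \sum_(y in U) adj x y <= 2 * #|[set E in edges G | E \subset U]|.
Proof.
set D := [set E in edges G | _].
have -> : \sum_(x in U) \sum_(y in U) adj x y =
    \sum_(z : G * G | [&& z.1 \in U, z.2 \in U & adj z.1 z.2]) 1.
  rewrite pair_big /= [LHS]big_mkcond [RHS]big_mkcond; apply: eq_bigr => -[x y] _ /=.
  by case: (x \in U); case: (y \in U); case: (adj _ _).
rewrite (partition_big (fun z : G * G => [set z.1; z.2]) (mem D)) /= => [|[x y] /and3P[xU yU xy]]; last first.
  rewrite inE; apply/andP; split; last by rewrite subUset !sub1set xU.
  by rewrite inE; apply/existsP; exists x; apply/existsP; exists y; rewrite xy /=.
rewrite mulnC -sum_nat_const; apply: leq_sum => E.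
rewrite !inE => /andP[/existsP[x /existsP[y /andP[xy /eqP ->]]] _].
rewrite sum1dep_card; apply: leq_trans (_ : #|[set (x, y); (y, x)]| <= 2); last first.
  by rewrite cards2; case: (_ != _).
apply: subset_leq_card; apply/subsetP => [[a b]]; rewrite !inE /= => /andP[/and3P[_ _ ab] /eqP E'].
have : a \in [set x; y] by rewrite -E' !inE eqxx.
have : b \in [set x; y] by rewrite -E' !inE eqxx orbT.
rewrite !inE !xpair_eqE => /orP[] /eqP bE /orP[] /eqP aE; move: ab;
  by rewrite aE bE ?adj_irrefl ?eqxx ?orbT.
Qed.

End Walks.

(** * Density of induced subgraphs *)

Section Mad.
Import Order.TTheory GRing.Theory Num.Theory.

Lemma mad_induced (G : sgraph) k (U : {set G}) : 0 < k -> U != set0 ->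
  (mad G < 2 + 1 / k%:R)%R ->
  2 * k * #|[set E in edges G | E \subset U]| < (2 * k + 1) * #|U|.
Proof.
move=> k0 U0; set D := [set E in _ | _] => hmad.
have sub : is_subgraph (U, D) && ((U, D).1 != set0).
  rewrite U0 andbT /is_subgraph /=; apply/andP; split.
    by apply/subsetP => E; rewrite inE => /andP[].
  by apply/forall_inP => E; rewrite inE => /andP[].
have : (((2 * #|D|)%:R / #|U|%:R : rat) <= mad G)%R.
  exact: (le_bigmax_cond _ (fun H : {set G} * {set {set G}} => (2 * #|H.2|)%:R / #|H.1|%:R)%R sub).
move/le_lt_trans => /(_ _ hmad).
have U0' : (0 < #|U|%:R :> rat)%R by rewrite ltr0n card_gt0.
have k0' : (0 < k%:R :> rat)%R by rewrite ltr0n.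
rewrite ltr_pdivrMr // -(ltr_pM2l k0').
rewrite mulrA mulrDr mul1r mulfV ?gt_eqF //.
have -> : (k%:R * 2 + 1 = (2 * k + 1)%:R :> rat)%R by rewrite natrD natrM mulrC.
by rewrite -!natrM ltr_nat mulnA [k * 2]mulnC.
Qed.
End Mad.

(** * Elimination of vertices *)

Lemma card_ord_set k : #|[set: 'I_(2 * k + 1)]| = 2 * k + 1.
Proof. by rewrite cardsT card_ord. Qed.

Section Elimination.
Variables (G : sgraph) (k : nat).
Hypothesis og : le_enat (2 * k + 1) (odd_girth G).

(* Here p x y and q x y are the bounds p x y <= #|f x :&: f y| <= k - q x y, given
   by an even walk of length 2(k-p) and an odd walk of length 2(k-q)+1; the
   value 0 means that there is no constraint. *)
Definition even_weight p := if p is 0 then 0 else 2 * p + 1.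
Definition pair_weight p q := even_weight p + 2 * q.

(** The walks through [v] are concatenated: two odd or two even ones make an even walk, one of each
    an odd walk. Truncated subtraction turns a walk too long to constrain anything into the void
    value 0. *)
Definition elim_even (v : G) (p q : G -> G -> nat) x y :=
  maxn (p x y) (maxn (q v x + q v y - k.+1) (p v x + p v y - k)).
Definition elim_odd (v : G) (p q : G -> G -> nat) x y :=
  maxn (q x y) (maxn (q v x + p v y - k) (p v x + q v y - k)).

(** Lengths add along [v], so constraints of weights w and w' produce one of weight w + w' - m; each
    maximum is bounded by a sum. *)
Lemma pair_weight_elim p q px qx py qy : px <= k -> py <= k -> qx <= k -> qy <= k ->
  pair_weight (maxn p (maxn (qx + qy - k.+1) (px + py - k)))
              (maxn q (maxn (qx + py - k) (px + qy - k))) <=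
  pair_weight p q + (2 * qx + 2 * qy - (2 * k + 1)
    + (even_weight px + even_weight py - (2 * k + 1))
    + (2 * qx + even_weight py - (2 * k + 1))
    + (even_weight px + 2 * qy - (2 * k + 1))).
Proof.
have ew n : even_weight n = 2 * n + (0 < n) by case: n => // n; rewrite /= addn1.
move=> hpx hpy hqx hqy; rewrite /pair_weight.
have h1 : even_weight (maxn p (maxn (qx + qy - k.+1) (px + py - k))) <=
    even_weight p + (2 * qx + 2 * qy - (2 * k + 1))
    + (even_weight px + even_weight py - (2 * k + 1)).
  rewrite !ew; case: (posnP px) hpx => [->|px0] hpx; case: (posnP py) hpy => [->|py0] hpy /=; lia.
have h2 : 2 * maxn q (maxn (qx + py - k) (px + qy - k)) <=
    2 * q + (2 * qx + even_weight py - (2 * k + 1))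
    + (even_weight px + 2 * qy - (2 * k + 1)).
  rewrite !ew; case: (posnP px) hpx => [->|px0] hpx; case: (posnP py) hpy => [->|py0] hpy /=; lia.
by move: h1 h2; clear; lia.
Qed.

Definition realized (p q : G -> G -> nat) := forall x y,
  [/\ p x y = p y x /\ q x y = q y x, p x y <= k /\ q x y <= k,
      0 < p x y -> walk (2 * (k - p x y)) x y &
      0 < q x y -> walk (2 * (k - q x y) + 1) x y].

Lemma realized_elim v p q : realized p q -> realized (elim_even v p q) (elim_odd v p q).
Proof.
move=> R x y.
have [[sp sq] [pk qk] wp wq] := R x y.
have [_ [pxk qxk] wpx wqx] := R v x; have [_ [pyk qyk] wpy wqy] := R v y.
split.
- by rewrite /elim_even /elim_odd -sp -sq [q v y + _]addnC [p v y + _]addnC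
    [q v y + _]addnC [p v y + _]addnC; split; rewrite // [in RHS](maxnC (_ - k) (_ - k)).
- by rewrite /elim_even /elim_odd; clear -pk qk pxk qxk pyk qyk; lia.
- rewrite /elim_even; case: (leqP (maxn _ (p v x + p v y - k)) (p x y)) => _ //.
  case: (leqP (p v x + p v y - k) (q v x + q v y - k.+1)) => _ h.
    have hx : 0 < q v x by clear -h qxk qyk; lia.
    have hy : 0 < q v y by clear -h qxk qyk; lia.
    have := walk_cat (walk_sym (wqx hx)) (wqy hy).
    by congr walk; clear -h qxk qyk; lia.
  have hx : 0 < p v x by clear -h pxk pyk; lia.
  have hy : 0 < p v y by clear -h pxk pyk; lia.
  have := walk_cat (walk_sym (wpx hx)) (wpy hy).
  by congr walk; clear -h pxk pyk; lia.
rewrite /elim_odd; case: (leqP (maxn _ (p v x + q v y - k)) (q x y)) => _ //.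
case: (leqP (p v x + q v y - k) (q v x + p v y - k)) => _ h.
  have hx : 0 < q v x by clear -h qxk pyk; lia.
  have hy : 0 < p v y by clear -h qxk pyk; lia.
  have := walk_cat (walk_sym (wqx hx)) (wpy hy).
  by congr walk; clear -h qxk pyk; lia.
have hx : 0 < p v x by clear -h pxk qyk; lia.
have hy : 0 < q v y by clear -h pxk qyk; lia.
have := walk_cat (walk_sym (wpx hx)) (wqy hy).
by congr walk; clear -h pxk qyk; lia.
Qed.

(** Each constraint is counted from both ends, hence the factor 2 in front of m. *)
Definition sparse (W : {set G}) (p q : G -> G -> nat) := forall U : {set G},
  U \subset W -> U != set0 ->
  \sum_(x in U) \sum_(y in U | y != x) pair_weight (p x y) (q x y)
    < 2 * (2 * k + 1) * #|U|.

(** The boolean separates the even constraint ([true]) from the odd one, so that [sum_excess] runs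
    over single constraints. *)
Definition constraint_weight (v : G) (p q : G -> G -> nat) (U : {set G}) (i : G * bool) :=
  if i.1 \in U then if i.2 then even_weight (p v i.1) else 2 * q v i.1 else 0.

Lemma sum_constraint_weight v p q U :
  \sum_i constraint_weight v p q U i = \sum_(x in U) pair_weight (p v x) (q v x).
Proof.
rewrite [RHS]big_mkcond -(pair_bigA _ (fun x b => constraint_weight v p q U (x, b))) /=.
apply: eq_bigr => x _; rewrite big_bool /constraint_weight /=.
by case: (x \in U).
Qed.

Lemma constraint_weight_leq v p q U i : realized p q ->
  constraint_weight v p q U i <= 2 * k + 1.
Proof.
move=> R; have [_ [] + + _ _] := R v i.1; rewrite /constraint_weight.
case: (_ \in U); last by [].
by case: i.2; [rewrite /even_weight; case: (p _ _) => // n|]; clear; lia.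
Qed.

(** By [sum_excess] the new weight inside [U], counted from both ends, is at most twice the excess
    over m of the weight from [v] to [U]. Without excess, the old bound for [U] suffices; otherwise
    it follows from the old bound for [v |: U]. *)
Lemma sparse_elim v W p q : realized p q -> sparse W p q -> v \in W ->
  \sum_(y in W | y != v) pair_weight (p v y) (q v y) < 2 * (2 * k + 1) ->
  sparse (W :\ v) (elim_even v p q) (elim_odd v p q).
Proof.
move=> R sp vW lowv U UW U0.
have vU : v \notin U by apply/negP => /(subsetP UW); rewrite !inE eqxx.
have UW' : U \subset W by rewrite (subset_trans UW) ?subD1set.
pose w := constraint_weight v p q U.
have sumw : \sum_i w i = \sum_(y in U) pair_weight (p v y) (q v y) by exact: sum_constraint_weight.
have w2 : \sum_i w i < 2 * (2 * k + 1).
  apply: leq_ltn_trans lowv; rewrite sumw big_mkcond [leqRHS]big_mkcond.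
  apply: leq_sum => x _; case: (boolP (x \in U)) => // /(subsetP UW).
  by rewrite !inE => /andP[-> ->].
have exc := sum_excess (fun i => constraint_weight_leq v U i R) (ltnW w2).
rewrite -/w in exc.
have bound : \sum_(x in U) \sum_(y in U | y != x)
     pair_weight (elim_even v p q x y) (elim_odd v p q x y) <=
   \sum_(x in U) \sum_(y in U | y != x) pair_weight (p x y) (q x y)
   + \sum_i \sum_(j | j != i) (w i + w j - (2 * k + 1)).
  have -> : \sum_i \sum_(j | j != i) (w i + w j - (2 * k + 1)) =
     \sum_x \sum_b \sum_(j | j != (x, b)) (w (x, b) + w j - (2 * k + 1)).
    by rewrite pair_bigA; apply: eq_bigr => -[].
  rewrite [X in _ + X](bigID (mem U)) /= addnA; apply: leq_trans (leq_addr _ _).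
  rewrite -big_split; apply: leq_sum => x xU /=.
  have E b : \sum_(y in U | y != x) \sum_c (w (x, b) + w (y, c) - (2 * k + 1)) <=
      \sum_(j | j != (x, b)) (w (x, b) + w j - (2 * k + 1)).
    rewrite pair_big_dep /= big_mkcond [leqRHS]big_mkcond; apply: leq_sum => -[y c] _ /=.
    rewrite xpair_eqE negb_and; case: (y == x) => /=; first by rewrite !andbF.
    by case: (y \in U).
  rewrite big_bool /=; apply: leq_trans (leq_add (leqnn _) (leq_add (E true) (E false))).
  rewrite -!big_split; apply: leq_sum => y /andP[yU yx] /=.
  have [_ [pxk qxk] _ _] := R v x; have [_ [pyk qyk] _ _] := R v y.
  apply: leq_trans (pair_weight_elim _ _ pxk pyk qxk qyk) _.
  rewrite !big_bool leq_add2l /w /constraint_weight /= xU yU.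
  by clear; lia.
apply: leq_ltn_trans bound _; apply: leq_ltn_trans (leq_add (leqnn _) exc) _.
have [small|big] := leqP (\sum_i w i) (2 * k + 1).
  by move: small; rewrite -subn_eq0 => /eqP ->; rewrite muln0 addn0; exact: sp.
have := sp (v |: U); rewrite subUset sub1set vW UW' -card_gt0 cardsU1 vU => /(_ isT isT).
rewrite big_setU1 //=.
have -> : \sum_(y in v |: U | y != v) pair_weight (p v y) (q v y) = \sum_i w i.
  rewrite sumw; apply: eq_bigl => y; rewrite !inE.
  by case: (eqVneq y v) => [->|]; rewrite ?(negPf vU) ?andbT.
have -> : \sum_(x in U) \sum_(y in v |: U | y != x) pair_weight (p x y) (q x y) =
    \sum_i w i + \sum_(x in U) \sum_(y in U | y != x) pair_weight (p x y) (q x y).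
  rewrite sumw -big_split; apply: eq_bigr => x xU /=.
  have vx : v != x by apply: contraNneq vU => ->.
  rewrite (bigD1 v) /= ?inE ?eqxx //; congr (_ + _).
    by have [[-> ->] _ _ _] := R x v.
  apply: eq_bigl => y; rewrite !inE.
  by case: (eqVneq y v) => [->|]; rewrite ?(negPf vU) ?andbF ?andbT.
by rewrite mulnDr /=; move: (2 * _ * #|U|) (\sum_i w i) (\sum_(x in U) _) big => c a b; clear; lia.
Qed.

(** * Choice of the eliminated vertex and extension of the coloring *)

Lemma exists_light W p q : sparse W p q -> W != set0 ->
  exists2 v, v \in W &
    \sum_(y in W | y != v) pair_weight (p v y) (q v y) < 2 * (2 * k + 1).
Proof.
move=> sp W0; apply/exists_inP; apply: contraTT (sp W (subxx _) W0).
rewrite negb_exists_in => /forall_inP h; rewrite -leqNgt mulnC -sum_nat_const.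
by apply: leq_sum => x xW; rewrite leqNgt h.
Qed.

(** The odd girth enters here: an even and an odd walk between the same ends close up to an odd
    closed walk, of length at least 2k + 1. *)
Lemma realized_leq p q x y : realized p q -> p x y + q x y <= k.
Proof.
move=> R; have [[sp _] [pk qk] wp wq] := R x y.
have [px|px] := posnP (p x y); first by rewrite px.
have [qx|qx] := posnP (q x y); first by rewrite qx addn0.
have := odd_walk_girth og (walk_cat (wp px) (walk_sym (wq qx))).
rewrite addnA -mulnDr oddD mul2n odd_double /= => /(_ isT).
by clear -pk qk; lia.
Qed.

Lemma elimination n (W : {set G}) p q : #|W| = n -> realized p q -> sparse W p q ->
  exists f : G -> {set 'I_(2 * k + 1)}, (forall x, #|f x| = k) /\
    {in W &, forall x y, x != y ->
       p x y <= #|f x :&: f y| /\ #|f x :&: f y| + q x y <= k}.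
Proof.
elim: n W p q => [|n IH] W p q cW R sp.
  have [|C [_ _ cC]] := @exists_between _ set0 [set: 'I_(2 * k + 1)] k (sub0set _).
    by rewrite cards0 cardsT card_ord; clear; lia.
  exists (fun => C); split=> // x y.
  by rewrite (cards0_eq cW) inE.
have W0 : W != set0 by rewrite -card_gt0 cW.
have [v vW lowv] := exists_light sp W0.
have cWv : #|W :\ v| = n by move: cW; rewrite (cardsD1 v) vW => -[].
have [f [fk fW]] := IH _ _ _ cWv (realized_elim v R) (sparse_elim R sp vW lowv).
pose S (i : G * bool) := if i.2 then ~: f i.1 else f i.1.
pose u (i : G * bool) := if i.1 \in W :\ v then if i.2 then p v i.1 else q v i.1 else 0.
have cfC x : #|~: f x| = k.+1.
  by have := cardsC (f x); rewrite fk card_ord; clear; lia.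
have uk i : u i <= k.
  by rewrite /u; have [_ [? ?] _ _] := R v i.1; case: ifP => // _; case: i.2.
have [|B [_ cB hB]] := @feasible_avoidable _ _ k [set: 'I_(2 * k + 1)] S u.
  split=> // [|i|i j ij|].
  - by rewrite cardsT card_ord.
  - by rewrite subsetT /S; case: i.2; rewrite ?cfC ?fk; split=> //; clear; lia.
  - have [xW|xW] := boolP (i.1 \in W :\ v); last first.
      by rewrite {1}/u (negPf xW) add0n (leq_trans (uk j)) ?leq_addr.
    have [yW|yW] := boolP (j.1 \in W :\ v); last first.
      by rewrite {2}/u (negPf yW) addn0 (leq_trans (uk i)) ?leq_addr.
    rewrite /u /S xW yW; move: i j ij xW yW => [x b] [y c] /= ij xW yW.
    (* For the two constraints of one vertex, [f x] and its complement cover all colors, so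
       compatibility follows from [realized_leq]. *)
    move: ij; rewrite xpair_eqE negb_and; have [<- /= bc|xy _] := eqVneq x y.
      apply: leq_trans (_ : p v x + q v x <= _); last by rewrite (leq_trans (realized_leq v x R)) ?leq_addr.
      by case: b bc; case: c => //= _; rewrite addnC.
    (* For distinct vertices, compatibility is what the constraints added by the elimination
       guarantee for [f]. *)
    have [h1 h2] := fW x y xW yW xy.
    have dC (X Y : {set 'I_(2 * k + 1)}) : [set: _] :\: (X :|: ~: Y) = Y :\: X.
      by apply/setP => z; rewrite !inE negb_or negbK andbT.
    have := cardsID (f y) (f x); have := cardsID (f x) (f y).
    have := card_setDU (card_ord_set k) (subsetT (f x)) (subsetT (f y)).
    rewrite [f y :&: f x]setIC !fk; move: h1 h2; rewrite /elim_even /elim_odd.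
    case: b; case: c; rewrite ?dC ?[~: f x :|: _]setUC ?dC !setDE ?setCK ?[f y :&: f x]setIC;
      move: #|f x :&: f y| #|f y :&: ~: f x| #|f x :&: ~: f y| #|_ :&: ~: (f x :|: f y)|;
      move: (p v x) (p v y) (q v x) (q v y) (p x y) (q x y); clear; lia.
  - rewrite (eq_bigr (constraint_weight v p q (W :\ v))) => [|i _].
      rewrite sum_constraint_weight (eq_bigl (fun y => (y \in W) && (y != v))).
        by move: lowv; move: (\sum_(y in W | _) _) => c; clear; lia.
      by move=> y; rewrite !inE andbC.
    rewrite /u /S /constraint_weight; case: (i.1 \in _) => //.
    case: i.2; first by case: (p v i.1) => //= t; rewrite cfC subSnn.
    by case: (q v i.1) => //= t; rewrite fk subnn addn0.
exists (fun x => if x == v then B else f x); split=> [x|x y xW yW xy].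
  by case: eqP.
have hv z : z \in W -> z != v -> p v z <= #|B :&: f z| /\ #|B :&: f z| + q v z <= k.
  move=> zW zv; have := hB (z, true); have := hB (z, false).
  rewrite /u /S /= !inE zv zW /= !setDE setCK.
  have := cardsID (f z) B; rewrite setDE cB.
  by move: #|_ :&: f z| #|_ :&: ~: f z|; clear; lia.
rewrite [y == v]eq_sym; have [xv|xv] := eqVneq x v; have [yv|yv] := eqVneq v y.
- by rewrite xv yv eqxx in xy.
- by rewrite xv; apply: hv; rewrite // eq_sym.
- by rewrite -yv setIC; have [[-> ->] _ _ _] := R x v; exact: hv.
have [||] := fW x y _ _ xy; rewrite ?inE ?xv ?xW ?yW 1?eq_sym ?yv //.
by rewrite /elim_even /elim_odd; clear; lia.
Qed.
End Elimination.

Theorem theorem1p2 (k : nat) (G : sgraph) (hk : 2 <= k)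
    (hog : le_enat (2 * k + 1) (odd_girth G))
    (hmad : (mad G < 2 + 1 / k%:R)%R) :
  has_coloring G (2 * k + 1) k.
Proof.
have k0 : 0 < k by apply: leq_trans hk.
(* An edge is an odd walk of length 1 and forces disjoint sets; initially there are no even
   constraints. *)
pose q (x y : G) := if adj x y then k else 0.
have R : realized k (fun _ _ => 0) q.
  move=> x y; rewrite /q adj_sym; split=> //; first by case: ifP.
  by rewrite adj_sym; case: ifP => // xy _; rewrite subnn; exact: walk_adj.
have sp : sparse k setT (fun _ _ => 0) q.
  move=> U _ U0; have h := mad_induced k0 U0 hmad.
  (* Each edge weighs 2k = m - 1 and is counted from both ends. *)
  apply: leq_ltn_trans (_ : 2 * k * (2 * #|[set E in edges G | E \subset U]|) < _); last first.
    by rewrite mulnCA -[2 * _ * #|U|]mulnA ltn_mul2l.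
  apply: leq_trans (leq_mul (leqnn _) (sum_adj_leq U)).
  rewrite big_distrr; apply: leq_sum => x _; rewrite big_distrr /=.
  rewrite big_mkcondr; apply: leq_sum => y _; rewrite /q.
  by case: (y != x); case: (adj x y); rewrite // /pair_weight ?muln1 ?muln0.
have [f [fk fW]] := elimination hog (erefl _) R sp.
exists f; split=> // x y xy; have xny : x != y by apply: contraTneq xy => ->; rewrite adj_irrefl.
have [_] := fW x y (in_setT _) (in_setT _) xny; rewrite addnC.
by rewrite /q xy -leq_subRL // subnn leqn0 cards_eq0 setI_eq0.
Qed.
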